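(* Let $T$ and $B$ be lattice paths with steps $N=(0,1)$ and $E=(1,0)$ from the origin to a point $(x,y)\in\mathbb N^2$, with $T$ weakly above $B$, and let $k\ge1$. Then the pairs $(b,\ell)$ and $(t,r)$ have the same joint distribution over $\mathcal P^k(T,B)$, i.e. $$\sum_{\mathbf P\in\mathcal P^k(T,B)} u^{b(\mathbf P)}v^{\ell(\mathbf P)}=\sum_{\mathbf P\in\mathcal P^k(T,B)} u^{t(\mathbf P)}v^{r(\mathbf P)}.$$
   Context: $T$ weakly above $B$ means no point of $T$ is strictly below or strictly to the right of $B$. $\mathcal P(T,B)$ is the set of lattice paths with steps $N,E$ from the origin to $(x,y)$ lying weakly above $B$ and weakly below $T$. $\mathcal P^k(T,B)$ is the set of $k$-tuples $\mathbf P=(P_1,\dots,P_k)$ with each $P_i\in\mathcal P(T,B)$ and $P_i$ weakly above $P_{i+1}$ for $1\le i\le k-1$. For $\mathbf P\in\mathcal P^k(T,B)$: $t(\mathbf P)$ is the number of east steps of $P_1$ that are steps of $T$; $\ell(\mathbf P)$ is the number of north steps of $P_1$ that are steps of $T$; $b(\mathbf P)$ is the number of east steps of $P_k$ that are steps of $B$; $r(\mathbf P)$ is the number of north steps of $P_k$ that are steps of $B$. *)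

(* Defs.v *)
From HB Require Import structures.
From mathcomp Require Import all_boot all_order all_algebra.

Set Implicit Arguments.
Unset Strict Implicit.
Unset Printing Implicit Defensive.

Import GRing.Theory.

(* A path starting at the origin is encoded by the
   sequence of its steps, a point (a, b) by a pair with abscissa first. *)
Definition North : bool := true.
Definition East : bool := false.

Definition move (p : nat * nat) (s : bool) : nat * nat :=
  if s == North then (p.1, p.2.+1) else (p.1.+1, p.2).

Definition points (w : seq bool) : seq (nat * nat) :=
  (0, 0) :: scanl move (0, 0) w.

Definition endpoint (w : seq bool) : nat * nat := foldl move (0, 0) w.

(* A step of a path is a unit segment of the plane: its starting point together
   with its direction.  Two paths share a step when they share this segment. *)
Definition steps (w : seq bool) : seq ((nat * nat) * bool) := zip (points w) w.

(* A path from the origin to (x, y) necessarily has x + y steps. *)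
Record lpath (x y : nat) := LPath {
  word :> (x + y).-tuple bool;
  _ : endpoint word == (x, y) }.

HB.instance Definition _ (x y : nat) := [isSub for @word x y].
HB.instance Definition _ (x y : nat) := [Finite of lpath x y by <:].

(* Only lattice points are compared: for paths with unit steps this gives the
   same order as comparing all points of the segments. *)
(* The path B meets the vertical line through p, only above p. *)
Definition strictly_below (p : nat * nat) (B : seq bool) : bool :=
  has (fun q => q.1 == p.1) (points B) &&
  all (fun q => (q.1 == p.1) ==> (p.2 < q.2)) (points B).

(* The path B meets the horizontal line through p, only to the left of p. *)
Definition strictly_right (p : nat * nat) (B : seq bool) : bool :=
  has (fun q => q.2 == p.2) (points B) &&
  all (fun q => (q.2 == p.2) ==> (q.1 < p.1)) (points B).

Definition weakly_above (T B : seq bool) : bool :=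
  all (fun p => ~~ (strictly_below p B || strictly_right p B)) (points T).

Definition paths_between (x y : nat) (T B : lpath x y) : {set lpath x y} :=
  [set P : lpath x y | weakly_above P B & weakly_above T P].

(* [sorted] compares consecutive entries only. *)
Definition path_tuples (k x y : nat) (T B : lpath x y) :
    {set k.-tuple (lpath x y)} :=
  [set P : k.-tuple (lpath x y) |
    all [in paths_between T B] P &
    sorted (fun P1 P2 : lpath x y => weakly_above P1 P2) P].

Definition common_steps (d : bool) (P Q : seq bool) : nat :=
  count (fun s => (s.2 == d) && (s \in steps Q)) (steps P).

(* The uppermost path P_1 is the head of the tuple and the lowermost path P_k
   its last entry; the default values are reached only for the empty tuple. *)
Definition stat_t (k x y : nat) (T : lpath x y) (P : k.-tuple (lpath x y)) :
  nat := common_steps East (head T P) T.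
Definition stat_l (k x y : nat) (T : lpath x y) (P : k.-tuple (lpath x y)) :
  nat := common_steps North (head T P) T.
Definition stat_b (k x y : nat) (B : lpath x y) (P : k.-tuple (lpath x y)) :
  nat := common_steps East (last B P) B.
Definition stat_r (k x y : nat) (B : lpath x y) (P : k.-tuple (lpath x y)) :
  nat := common_steps North (last B P) B.

(* Main.v *)
Require Import Defs.
From mathcomp Require Import all_boot all_order all_algebra.
From mathcomp Require Import zify ring.

(* Index matrices by paths: let M be the zeta matrix of the order "weakly
   above", and let N_v and E_u be M with every entry weighted by v, respectively
   u, to the number of common north, respectively east, steps.  The two sums of
   the theorem are the (T, B) entries of N_v M^(k-1) E_u and E_u M^(k-1) N_v, so
   it suffices that N_v and E_u commute (then both commute with M = N_1 = E_1),
   which is the case k = 1.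

   For k = 1 the statement is the independence of the Tutte polynomial of a
   lattice path matroid from the order of its ground set: one side satisfies the
   deletion-contraction recursion in the last step of the path, the other the
   same recursion in the first step.  The two recursions commute, except when
   the first and last steps are parallel or in series, that is, when the region
   between the boundaries is a full rectangle of width or height one; there both
   sides are computed explicitly. *)

Set Implicit Arguments.
Unset Strict Implicit.
Unset Printing Implicit Defensive.

Import GRing.Theory.
Local Open Scope ring_scope.

(** * The two recursions *)

Section Recursions.
Variables (A : comNzRingType) (u v : A) (R : nat -> nat -> bool).

(* [h] and [n] tell whether the horizontal and the vertical neighbor of a point
   lie in the region.  When only the vertical one does, the step to it runs along
   a boundary and is counted by [v], and likewise with [u]. *)
Definition tutte_step (h n : bool) (x y : A) : A :=
  if h then (if n then x + y else u * x) else (if n then v * y else 1).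

(** Unless both flags are false, [tutte_step h n] is a linear form in its last two arguments, and
    two linear forms applied to the rows and the columns of a 2 by 2 array commute. *)
Lemma tutte_step_comm (h n h' n' : bool) x11 x12 x21 x22 :
  h || n -> h' || n' ->
  tutte_step h n (tutte_step h' n' x11 x12) (tutte_step h' n' x21 x22) =
  tutte_step h' n' (tutte_step h n x11 x21) (tutte_step h n x12 x22).
Proof. by case: h; case: n; case: h'; case: n' => //= _ _; ring. Qed.

Lemma eq_tutte_step (h n : bool) x y x' y' :
  (h -> x = x') -> (n -> y = y') -> tutte_step h n x y = tutte_step h n x' y'.
Proof. by case: h; case: n => //= hx hy; rewrite ?hx ?hy. Qed.

(* Weighted count of the paths from (a, b) to (c, d) in the region R, by their
   last step; the fuel n is meant to be (c - a) + (d - b). *)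
Fixpoint last_sum (n a b c d : nat) : A :=
  if n is m.+1 then
    tutte_step ((a < c)%N && R c.-1 d) ((b < d)%N && R c d.-1)
         (last_sum m a b c.-1 d) (last_sum m a b c d.-1)
  else 1.

(** At this end the same flags detect the other boundary: for the region between [T] and [B], a
    forced north step runs along [T] in [last_sum] and along [B] here. *)
Fixpoint first_sum (n a b c d : nat) : A :=
  if n is m.+1 then
    tutte_step ((a < c)%N && R a.+1 b) ((b < d)%N && R a b.+1)
         (first_sum m a.+1 b c d) (first_sum m a b.+1 c d)
  else 1.

Lemma last_sum_col n a b :
  (forall j, (b <= j <= b + n)%N -> R a j) -> last_sum n a b a (b + n) = v ^+ n.
Proof.
elim: n => //= n IHn Rab; rewrite ltnn addnS ltnS leq_addr /= Rab; last by lia.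
by rewrite IHn ?exprS // => j hj; apply: Rab; lia.
Qed.

Lemma first_sum_col n a b :
  (forall j, (b <= j <= b + n)%N -> R a j) -> first_sum n a b a (b + n) = v ^+ n.
Proof.
elim: n b => //= n IHn b Rab.
rewrite ltnn addnS ltnS leq_addr /= Rab; last by lia.
by rewrite -addSn IHn ?exprS // => j hj; apply: Rab; lia.
Qed.

(** The single east step, [j] units above [b], leaves [j] north steps in the left column, each
    counted by [v]; the factor [u] appears only for [j = 0]. *)
Lemma last_sum_strip n a b :
  (forall j, (b <= j <= b + n)%N -> R a j && R a.+1 j) ->
  last_sum n.+1 a b a.+1 (b + n) = u + \sum_(i < n) v ^+ i.+1.
Proof.
elim: n => [|n IHn] Rab.
  have /andP[Rab0 _] := Rab b ltac:(lia).
  by rewrite /= addn0 leqnn ltnn Rab0 /= mulr1 big_ord0 addr0.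
have /andP[R1 _] := Rab (b + n.+1)%N ltac:(lia).
have /andP[_ R2] := Rab (b + n)%N ltac:(lia).
have -> : last_sum n.+2 a b a.+1 (b + n.+1) =
    last_sum n.+1 a b a (b + n.+1) + last_sum n.+1 a b a.+1 (b + n).
  rewrite [LHS](_ : _ = tutte_step ((a < a.+1)%N && R a (b + n.+1))
    ((b < b + n.+1)%N && R a.+1 (b + n.+1).-1)
    (last_sum n.+1 a b a (b + n.+1)) (last_sum n.+1 a b a.+1 (b + n.+1).-1)) //.
  by rewrite addnS /= R2 -addnS R1 /tutte_step; case: ifP => //; case: ifP => //; lia.
rewrite IHn; last by move=> j hj; apply: Rab; lia.
rewrite last_sum_col; last by move=> j /Rab /andP[].
by rewrite big_ord_recr /=; ring.
Qed.

(** Now the north steps of the right column count and [u] marks the east step at the top, which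
    reverses the order of the terms but keeps the sum. *)
Lemma first_sum_strip n a b :
  (forall j, (b <= j <= b + n)%N -> R a j && R a.+1 j) ->
  first_sum n.+1 a b a.+1 (b + n) = u + \sum_(i < n) v ^+ i.+1.
Proof.
elim: n b => [|n IHn] b Rab.
  have /andP[_ Rab0] := Rab b ltac:(lia).
  by rewrite /= addn0 leqnn ltnn Rab0 /= mulr1 big_ord0 addr0.
have /andP[_ R1] := Rab b ltac:(lia).
have /andP[R2 _] := Rab b.+1 ltac:(lia).
have -> : first_sum n.+2 a b a.+1 (b + n.+1) =
    first_sum n.+1 a.+1 b a.+1 (b + n.+1) + first_sum n.+1 a b.+1 a.+1 (b.+1 + n).
  rewrite addSnnS [LHS](_ : _ = tutte_step ((a < a.+1)%N && R a.+1 b)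
    ((b < b + n.+1)%N && R a b.+1)
    (first_sum n.+1 a.+1 b a.+1 (b + n.+1))
    (first_sum n.+1 a b.+1 a.+1 (b + n.+1))) //.
  by rewrite /= R2 R1 /tutte_step; case: ifP => //; case: ifP => //; lia.
rewrite IHn; last by move=> j hj; apply: Rab; lia.
rewrite first_sum_col; last by move=> j /Rab /andP[].
by rewrite big_ord_recr /=; ring.
Qed.

End Recursions.

(** Reflection in the diagonal exchanges [u] and [v], so strips of height one reduce to strips of
    width one. *)
Lemma last_sum_tr (A : comNzRingType) (u v : A) R n a b c d :
  last_sum u v R n a b c d = last_sum v u (fun i j => R j i) n b a d c.
Proof.
elim: n c d => //= n IHn c d; rewrite !IHn /tutte_step.
by case: ifP; case: ifP => // _ _; rewrite addrC.
Qed.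

Lemma first_sum_tr (A : comNzRingType) (u v : A) R n a b c d :
  first_sum u v R n a b c d = first_sum v u (fun i j => R j i) n b a d c.
Proof.
elim: n a b => //= n IHn a b; rewrite !IHn /tutte_step.
by case: ifP; case: ifP => // _ _; rewrite addrC.
Qed.

(** * Equality of the two recursions on a row- and column-convex region *)

Section LastFirst.
Variables (A : comNzRingType) (u v : A) (R : nat -> nat -> bool).
Hypothesis Rrow : forall a a' a'' b,
  (a <= a' <= a'')%N -> R a b -> R a'' b -> R a' b.
Hypothesis Rcol : forall a b b' b'',
  (b <= b' <= b'')%N -> R a b -> R a b'' -> R a b'.
Hypothesis Rprev : forall a b, R a.+1 b.+1 -> R a b.+1 || R a.+1 b.
Hypothesis Rnext : forall a b, R a b -> R a.+1 b || R a b.+1.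

Local Ltac natlia :=
  repeat match goal with H : ?T |- _ =>
    lazymatch T with
    | is_true (leq _ _) => fail
    | @eq nat _ _ => fail
    | @eq (Equality.sort _) _ _ => fail
    | nat => fail
    | _ => clear H
    end
  end; lia.

(** This keeps [last_sum] away from the constant branch of [tutte_step]. [Rprev] finds a predecessor
    when both coordinates can decrease; on the row or column of [(a, b)] convexity does. *)
Lemma prev_in_region a b c d : (a <= c)%N -> (b <= d)%N -> (a + b < c + d)%N ->
  R a b -> R c d -> (a < c)%N && R c.-1 d || (b < d)%N && R c d.-1.
Proof.
move=> ac bd ne Rab Rcd.
have [ltac|leca] := ltnP a c; have [ltbd|ledb] := ltnP b d => /=.
- by case: c d Rcd ltac ltbd {ac bd ne} => [//|c] [//|d] + _ _; apply: Rprev.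
- have e : b = d by natlia.
  rewrite -e in Rcd *.
  by rewrite orbF; apply: Rrow Rab Rcd; natlia.
- have e : a = c by natlia.
  by rewrite -e in Rcd *; apply: Rcol Rab Rcd; natlia.
- by natlia.
Qed.

Lemma next_in_region a b c d : (a <= c)%N -> (b <= d)%N -> (a + b < c + d)%N ->
  R a b -> R c d -> (a < c)%N && R a.+1 b || (b < d)%N && R a b.+1.
Proof.
move=> ac bd ne Rab Rcd.
have [ltac|leca] := ltnP a c; have [ltbd|ledb] := ltnP b d => /=.
- exact: Rnext.
- have e : b = d by natlia.
  rewrite -e in Rcd *.
  by rewrite orbF; apply: Rrow Rab Rcd; natlia.
- have e : a = c by natlia.
  by rewrite -e in Rcd *; apply: Rcol Rab Rcd; natlia.
- by natlia.
Qed.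

(** Expanding at the last and then at the first step, or in the other order, leads to the same four
    smaller sums, and [tutte_step_comm] exchanges the two expansions, provided that the flags at one
    end do not depend on the step removed at the other. Full strips violate this and are
    computed. *)
Lemma last_sum_first_sum n a b c d : (a <= c)%N -> (b <= d)%N ->
  n = ((c - a) + (d - b))%N -> R a b -> R c d ->
  last_sum u v R n a b c d = first_sum u v R n a b c d.
Proof.
(* The induction hypothesis is needed with one and with two steps fewer. *)
have [m] := ubnP n; elim: m n a b c d => // m IHm n a b c d lt_nm ac bd.
case: n lt_nm => [//|[|n]] lt_nm def_n Rab Rcd.
  have [ltac|leca] := ltnP a c.
    have ec : c = a.+1 by natlia.
    have ed : d = b by natlia.
    by subst; rewrite /= ltnn leqnn Rab Rcd.
  have ec : c = a by natlia.
  have ed : d = b.+1 by natlia.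
  by subst; rewrite /= ltnn leqnn Rab Rcd.
(* Full strip of width one: its four corners lie in the region, and column convexity gives the
   rest. *)
have [/andP[/eqP ec /andP[R1 R2]]|notcol] :=
    boolP ((c == a.+1) && (R a.+1 b && R a d)).
  have ed : d = (b + n.+1)%N by natlia.
  subst c d; rewrite last_sum_strip ?first_sum_strip // => j hj;
    by apply/andP; split; [apply: Rcol hj _ _ | apply: Rcol hj _ _].
have [/andP[/eqP ed /andP[R1 R2]]|notrow] :=
    boolP ((d == b.+1) && (R a b.+1 && R c b)).
  have ec : c = (a + n.+1)%N by natlia.
  subst c d; rewrite last_sum_tr first_sum_tr last_sum_strip ?first_sum_strip //;
    by move=> j hj; apply/andP; split; [apply: Rrow hj _ _ | apply: Rrow hj _ _].
have ne : (a + b < c + d)%N by natlia.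
have := prev_in_region ac bd ne Rab Rcd; have := next_in_region ac bd ne Rab Rcd.
set W := (a < c)%N && R c.-1 d; set S := (b < d)%N && R c d.-1.
set E := (a < c)%N && R a.+1 b; set N := (b < d)%N && R a b.+1 => EN WS.
(* If a horizontal step can be removed at either end, the width is at least two: width one would put
   all four corners in the region, the strip case excluded above. *)
have WE : W -> E -> (a.+1 < c)%N.
  case/andP=> ltac R1 /andP[_ R2]; rewrite ltn_neqAle ltac andbT.
  apply: contra notcol => /eqP ec; rewrite -ec eqxx /=.
  by rewrite -ec /= in R1; rewrite R1 R2.
have SN : S -> N -> (b.+1 < d)%N.
  case/andP=> ltbd R1 /andP[_ R2]; rewrite ltn_neqAle ltbd andbT.
  apply: contra notrow => /eqP ed; rewrite -ed eqxx /=.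
  by rewrite -ed /= in R1; rewrite R1 R2.
(* Hence the flags at one end survive the removal of a step at the other. *)
have defE : W -> (a < c.-1)%N && R a.+1 b = E.
  move=> hW; apply/andP/andP=> [[lt1 R2]|hE].
    by split=> //; natlia.
  by have lt1 := WE hW (introT andP hE); case: hE => _ R2; split=> //; natlia.
have defN : S -> (b < d.-1)%N && R a b.+1 = N.
  move=> hS; apply/andP/andP=> [[lt1 R2]|hN].
    by split=> //; natlia.
  by have lt1 := SN hS (introT andP hN); case: hN => _ R2; split=> //; natlia.
have defW : E -> (a.+1 < c)%N && R c.-1 d = W.
  move=> hE; apply/andP/andP=> [[lt1 R2]|hW].
    by split=> //; natlia.
  by have lt1 := WE (introT andP hW) hE; case: hW => _ R2; split.
have defS : N -> (b.+1 < d)%N && R c d.-1 = S.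
  move=> hN; apply/andP/andP=> [[lt1 R2]|hS].
    by split=> //; natlia.
  by have lt1 := SN (introT andP hS) hN; case: hS => _ R2; split.
(* The left side is expanded at the last step and then, by induction, at the first; the right side
   is expanded below in the opposite order. *)
transitivity (tutte_step u v W S
  (tutte_step u v E N (first_sum u v R n a.+1 b c.-1 d) (first_sum u v R n a b.+1 c.-1 d))
  (tutte_step u v E N (first_sum u v R n a.+1 b c d.-1) (first_sum u v R n a b.+1 c d.-1))).
  apply: (@eq_tutte_step A u v W S) => [hW|hS].
    have /andP[ltac R1] := hW.
    by rewrite [LHS](IHm n.+1 a b c.-1 d) ?[LHS]/= ?defE //; natlia.
  have /andP[ltbd R1] := hS.
  by rewrite [LHS](IHm n.+1 a b c d.-1) ?[LHS]/= ?defN //; natlia.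
rewrite tutte_step_comm //; symmetry; apply: (@eq_tutte_step A u v E N) => [hE|hN].
  have /andP[ltac R1] := hE.
  rewrite -[LHS](IHm n.+1 a.+1 b c d) //; try natlia.
  rewrite [LHS]/= defW //; apply: (@eq_tutte_step A u v W S) => [hW|hS].
    by have ltac' := WE hW hE; have /andP[_ R2] := hW; rewrite [LHS]IHm //; natlia.
  by have /andP[ltbd R2] := hS; rewrite [LHS]IHm //; natlia.
have /andP[ltbd R1] := hN.
rewrite -[LHS](IHm n.+1 a b.+1 c d) //; try natlia.
rewrite [LHS]/= defS //; apply: (@eq_tutte_step A u v W S) => [hW|hS].
  by have /andP[ltac R2] := hW; rewrite [LHS]IHm //; natlia.
by have ltbd' := SN hS hN; have /andP[_ R2] := hS; rewrite [LHS]IHm //; natlia.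
Qed.
End LastFirst.

(** * Heights of paths and the region between two paths *)

(** The ordinate of the path on the antidiagonal [i]. A path meets each antidiagonal at most once,
    so the order of paths becomes the pointwise order of heights; past the end the height stays
    constant. *)
Definition height (w : seq bool) (i : nat) : nat := count id (take i w).

Lemma height0 w : height w 0 = 0%N.
Proof. by rewrite /height take0. Qed.

Lemma heightS w i : height w i.+1 = (height w i + nth false w i)%N.
Proof.
have [lt_i|le_i] := ltnP i (size w).
  by rewrite /height (take_nth false) // -cats1 count_cat /= addn0.
by rewrite /height !take_oversize ?nth_default ?addn0 // ltnW.
Qed.

Lemma height_le w i : (height w i <= i)%N.
Proof.
by elim: i => [|i IHi]; rewrite ?height0 // heightS; case: nth; lia.
Qed.

(** Neither coordinate decreases along a path; the upper bound says this for the abscissa. *)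
Lemma height_lip w i j : (i <= j)%N ->
  (height w i <= height w j <= height w i + (j - i))%N.
Proof.
move=> /subnKC <-; elim: (j - i)%N => [|k]; first by rewrite addn0; lia.
by rewrite addnS heightS; case: nth; lia.
Qed.

Lemma mem_points_from p w (q : nat * nat) :
  (q \in p :: scanl move p w) =
  (p.1 + p.2 <= q.1 + q.2 <= p.1 + p.2 + size w)%N &&
  (p.2 + height w (q.1 + q.2 - (p.1 + p.2)) == q.2)%N.
Proof.
case: q => c d; elim: w p => [|s w IHw] [a b]; rewrite in_cons.
  by rewrite /= in_nil orbF /height /= !addn0 xpair_eqE; lia.
rewrite [scanl _ _ _]/= IHw xpair_eqE /= /move.
have hcons k : height (s :: w) k.+1 = (s + height w k)%N by [].
have [lt|gt|eq] := ltngtP (a + b)%N (c + d)%N.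
- rewrite (_ : (c + d - (a + b)) = (c + d - (a + b).+1).+1)%N; last by lia.
  rewrite hcons; case: s {IHw hcons} => /=;
    rewrite ?addnS ?addSn; set k := height _ _; clearbody k; clear -lt; lia.
- by case: s {IHw hcons} => /=; move: (height w _) => k; lia.
- rewrite eq subnn height0.
  by case: s {IHw hcons} => /=; move: (height w _) => k; lia.
Qed.

Lemma mem_steps_from p w (q : nat * nat) d :
  ((q, d) \in zip (p :: scanl move p w) w) =
  [&& (p.1 + p.2 <= q.1 + q.2 < p.1 + p.2 + size w)%N,
      (p.2 + height w (q.1 + q.2 - (p.1 + p.2)) == q.2)%N
    & nth false w (q.1 + q.2 - (p.1 + p.2)) == d].
Proof.
case: q => e f; elim: w p => [|s w IHw] [a b].
  by rewrite /= in_nil; lia.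
rewrite [scanl _ _ _]/= [zip _ _]/= in_cons IHw !xpair_eqE /= /move.
have hcons k : height (s :: w) k.+1 = (s + height w k)%N by [].
have [lt|gt|eq] := ltngtP (a + b)%N (e + f)%N.
- rewrite (_ : (e + f - (a + b)) = (e + f - (a + b).+1).+1)%N; last by lia.
  rewrite hcons /=; case: s {IHw hcons} => /=; rewrite ?addnS ?addSn; set k := height _ _;
    set h := nth _ _ _; clearbody h k; clear -lt; lia.
- by case: s {IHw hcons} => /=; move: (height w _) (nth _ w _) => k h; lia.
- rewrite eq subnn height0 [nth _ (s :: w) 0]/= (eq_sym d).
  by case: s {IHw hcons} => /=; move: (height w _) (nth _ w _) => k h; lia.
Qed.

Lemma mem_points w (q : nat * nat) :
  (q \in points w) = (q.1 + q.2 <= size w)%N && (height w (q.1 + q.2) == q.2).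
Proof. by rewrite mem_points_from /= subn0. Qed.

Lemma mem_steps w (q : nat * nat) d :
  ((q, d) \in steps w) = [&& (q.1 + q.2 < size w)%N,
    height w (q.1 + q.2) == q.2 & nth false w (q.1 + q.2) == d].
Proof. by rewrite mem_steps_from /= subn0. Qed.

Lemma foldl_move p w :
  foldl move p w = (p.1 + (size w - count id w), p.2 + count id w)%N.
Proof.
elim: w p => [|s w IHw] [a b] /=; first by rewrite !addn0.
rewrite IHw /move; have := count_size id w; move: (count id w) => k hk.
by case: s => /=; congr pair; lia.
Qed.

Lemma size_lpath x y (P : lpath x y) : size P = (x + y)%N.
Proof. exact: size_tuple. Qed.

Lemma height_end x y (P : lpath x y) i : (x + y <= i)%N -> height P i = y.
Proof.
case: P => w ew /= le_i.
rewrite /height take_oversize ?size_tuple //.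
by move: ew; rewrite /endpoint foldl_move => /eqP[].
Qed.

Lemma abscissa_bounds x y (P : lpath x y) i : (i <= x + y)%N ->
  (i - x <= height P i <= y)%N.
Proof.
by move=> le_i; have := height_lip P le_i; rewrite (height_end P (leqnn _)); lia.
Qed.

(** If [T] is lower than [B] on an antidiagonal, its point there is strictly below [B]. Conversely,
    if a point of [T] were strictly below or to the right of [B], monotone coordinates and the
    inequality of heights would force [B] through this very point. *)
Lemma weakly_aboveP x y (T B : lpath x y) :
  reflect (forall i, height B i <= height T i)%N (weakly_above T B).
Proof.
apply: (iffP allP) => [aboveTB i | le_BT [a b]].
  have [le_i|lt_i] := leqP (x + y) i; first by rewrite !height_end.
  rewrite leqNgt; apply/negP => lt_TB.
  set a := (i - height T i)%N.
  have hT := height_le T i; have hB := height_le B i.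
  have Tp : (a, height T i) \in points T.
    by rewrite mem_points size_lpath /= subnK // eqxx andbT ltnW.
  apply: (negP (aboveTB _ Tp)).
  apply/orP; left; apply/andP; split.
    (* [B] meets the vertical line of abscissa [a] when its abscissa first reaches [a]; minimality
       makes this an equality. *)
    have exj : exists j, (a <= j - height B j)%N.
      exists (x + y)%N; rewrite (height_end B (leqnn _)) addnK.
      by have := abscissa_bounds T (ltnW lt_i); lia.
    have [j aj minj] := ex_minnP exj.
    have lejxy : (j <= x + y)%N.
      rewrite leqNgt; apply/negP => ltj; have := minj (x + y)%N.
      rewrite (height_end B (leqnn _)) addnK; have := abscissa_bounds T (ltnW lt_i).
      lia.
    apply/hasP; exists (a, j - a)%N => //=.
    rewrite mem_points size_lpath /=.
    have hBj := height_le B j.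
    case: j aj minj lejxy hBj => [|j] aj minj lejxy hBj.
      have a0 : a = 0%N by lia.
      by rewrite a0 addn0 subn0 height0 eqxx.
    have := minj j; have := height_le B j.
    have := height_lip B (leqnSn j); rewrite subnKC //; lia.
  apply/allP => -[c d]; rewrite mem_points size_lpath /= => /andP[le_cd /eqP hcd].
  apply/implyP => /eqP eca; rewrite eca in le_cd hcd.
  have [le|lt] := leqP i (a + d).
    by have := height_lip B le; lia.
  by have := height_lip B (ltnW lt); lia.
rewrite mem_points size_lpath /= => /andP[le_ab /eqP hab].
have hBT := le_BT (a + b)%N; rewrite hab in hBT.
have inB : height B (a + b) = b -> (a, b) \in points B.
  by move=> eb; rewrite mem_points size_lpath /= le_ab eb eqxx.
rewrite negb_or; apply/andP; split; apply/negP => /andP[];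
  move=> /hasP[[c d] /[!(mem_points, size_lpath)] /andP[lecd /eqP hcd] /eqP eca] /allP notB;
  rewrite /= in eca lecd hcd; rewrite eca in lecd hcd.
- have lt_bd : (b < d)%N.
    by have := notB (a, d); rewrite mem_points size_lpath /= lecd hcd !eqxx /=; apply.
  have eb : height B (a + b) = b.
    have le : (a + b <= a + d)%N by lia.
    by have := height_lip B le; lia.
  by have := notB (a, b) (inB eb); rewrite /= eqxx ltnn.
- have lt_ca : (c < a)%N.
    by have := notB (c, b); rewrite mem_points size_lpath /= lecd hcd !eqxx /=; apply.
  have eb : height B (a + b) = b.
    have le : (c + b <= a + b)%N by lia.
    by have := height_lip B le; lia.
  by have := notB (a, b) (inB eb); rewrite /= eqxx ltnn.
Qed.

Lemma weakly_above_trans x y : transitive (fun P Q : lpath x y => weakly_above P Q).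
Proof.
move=> Q P S /weakly_aboveP hPQ /weakly_aboveP hQS; apply/weakly_aboveP => i.
exact: leq_trans (hQS i) (hPQ i).
Qed.

(** * The region between two boundary paths *)

Section Region.
Variables (x y : nat) (T B : lpath x y).
(** Past the antidiagonal of [(x, y)] both heights equal [y], so the region goes on as a horizontal
    ray; this lets [region_next] hold without bounds. *)
Definition region (a b : nat) : bool :=
  (height B (a + b) <= b <= height T (a + b))%N.

Lemma region_row a a' a'' b :
  (a <= a' <= a'')%N -> region a b -> region a'' b -> region a' b.
Proof.
move=> /andP[le1 le2]; rewrite /region.
have := @height_lip T (a + b) (a' + b); have := @height_lip B (a' + b) (a'' + b).
by lia.
Qed.

Lemma region_col a b b' b'' :
  (b <= b' <= b'')%N -> region a b -> region a b'' -> region a b'.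
Proof.
move=> /andP[le1 le2]; rewrite /region.
have := @height_lip B (a + b) (a + b'); have := @height_lip T (a + b') (a + b'').
by lia.
Qed.

Lemma region_origin : region 0 0.
Proof. by rewrite /region !height0. Qed.

Lemma region_end : region x y.
Proof. by rewrite /region !height_end ?leqnn. Qed.

(** This lemma and the next relate the flags seen from the end of a step to the boundaries, for
    [last_sum]; the two after them do so from the start of a step, for [first_sum]. *)
Lemma north_step_top c d : (c + d < x + y)%N -> region c d -> region c d.+1 ->
  (((c, d), North) \in steps T) = ~~ ((0 < c)%N && region c.-1 d.+1).
Proof.
rewrite mem_steps size_lpath /region /= => -> /=.
have := heightS T (c + d); have := height_lip B (leqnSn (c + d)).
have := height_le T (c + d).
by case: c => [|c] /=; rewrite ?add0n ?addSn ?addnS /North; case: nth; lia.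
Qed.

Lemma east_step_bottom c d : (c + d < x + y)%N -> region c d -> region c.+1 d ->
  (((c, d), East) \in steps B) = ~~ ((0 < d)%N && region c.+1 d.-1).
Proof.
rewrite mem_steps size_lpath /region /= => -> /=.
have := heightS B (c + d); have := height_lip T (leqnSn (c + d)).
have := height_le B (c + d).
by case: d => [|d] /=; rewrite ?addn0 ?addSn ?addnS /East; case: nth; lia.
Qed.

Lemma east_step_top a b : (a + b < x + y)%N -> region a b -> region a.+1 b ->
  (((a, b), East) \in steps T) = ~~ ((b < y)%N && region a b.+1).
Proof.
move=> lt; rewrite mem_steps size_lpath /region /= lt /=.
have := heightS T (a + b); have := height_lip B (leqnSn (a + b)).
have := abscissa_bounds T lt.
by rewrite ?addSn ?addnS /East; case: nth; lia.
Qed.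

Lemma north_step_bottom a b : (a + b < x + y)%N -> region a b -> region a b.+1 ->
  (((a, b), North) \in steps B) = ~~ ((a < x)%N && region a.+1 b).
Proof.
move=> lt; rewrite mem_steps size_lpath /region /= lt /=.
have := heightS B (a + b); have := height_lip T (leqnSn (a + b)).
have := abscissa_bounds B lt.
by rewrite ?addSn ?addnS /North; case: nth; lia.
Qed.

Hypothesis hTB : weakly_above T B.

Lemma region_prev a b : region a.+1 b.+1 -> region a b.+1 || region a.+1 b.
Proof.
rewrite /region addSn !addnS.
have := height_lip B (leqnSn (a + b).+1).
have := height_lip T (leqnSn (a + b).+1).
have := elimT (weakly_aboveP T B) hTB (a + b).+1.
by rewrite addSn; lia.
Qed.

Lemma region_next a b : region a b -> region a.+1 b || region a b.+1.
Proof.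
rewrite /region addSn !addnS.
have := height_lip B (leqnSn (a + b)).
have := height_lip T (leqnSn (a + b)).
have := elimT (weakly_aboveP T B) hTB (a + b).+1.
by lia.
Qed.

End Region.

(** * The case of a single path *)

Lemma big_tuple_cons (V : nmodType) (I : finType) n (F : n.+1.-tuple I -> V) :
  \sum_t F t = \sum_i \sum_(t : n.-tuple I) F [tuple of i :: t].
Proof.
rewrite pair_big /= (reindex (fun p : I * n.-tuple I => [tuple of p.1 :: p.2])) //.
exists (fun t => (thead t, [tuple of behead t])) => [[i t] _ | t _] /=.
  by congr pair; apply: val_inj.
by rewrite -tuple_eta.
Qed.

(** * Path sums with local step weights *)

Section PathSum.
Variables (A : comNzRingType) (omega : nat * nat -> bool -> A).

Fixpoint weight (p : nat * nat) (w : seq bool) : A :=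
  if w is s :: w' then omega p s * weight (move p s) w' else 1.

Fixpoint path_sum (n : nat) (p q : nat * nat) : A :=
  if n is m.+1 then
    omega p North * path_sum m (move p North) q +
    omega p East * path_sum m (move p East) q
  else (p == q)%:R.

Lemma path_sum_tuple n p q :
  \sum_(w : n.-tuple bool) (foldl move p w == q)%:R * weight p w = path_sum n p q.
Proof.
elim: n p => [|n IHn] p.
  rewrite (big_pred1 [tuple]) ?mulr1 // => t.
  by rewrite [t]tuple0 /= eq_refl.
rewrite big_tuple_cons big_bool /= -!IHn !mulr_sumr.
by congr (_ + _); apply: eq_bigr => w _; rewrite mulrCA.
Qed.

(** The definition of [path_sum] peels off the first step, this identity the last one. The factors
    [(0 < d)%:R] and [(0 < c)%:R] discard the spurious predecessors due to [0.-1 = 0]. *)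
Lemma path_sum_last n p c d :
  path_sum n.+1 p (c, d) =
  (0 < d)%:R * path_sum n p (c, d.-1) * omega (c, d.-1) North +
  (0 < c)%:R * path_sum n p (c.-1, d) * omega (c.-1, d) East.
Proof.
elim: n p => [|n IHn] p.
  case: p => a b /=; rewrite /move !xpair_eqE /=.
  congr (_ + _).
    case: d => [|d]; first by rewrite andbF mulr0 !mul0r.
    rewrite eqSS /= mul1r mulrC.
    by case: eqP => [->|]; case: eqP => [->|]; rewrite ?mul0r ?mul1r.
  case: c => [|c]; first by rewrite mulr0 !mul0r.
  rewrite eqSS /= mul1r mulrC.
  by case: eqP => [->|]; case: eqP => [->|]; rewrite ?mul0r ?mul1r.
have unfold q : path_sum n.+1 p q = omega p North * path_sum n (move p North) q +
    omega p East * path_sum n (move p East) q by [].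
transitivity (omega p North * path_sum n.+1 (move p North) (c, d) +
  omega p East * path_sum n.+1 (move p East) (c, d)); first by [].
by rewrite !IHn !unfold; ring.
Qed.

Lemma path_sum_gt n (p q : nat * nat) :
  (q.1 < p.1)%N || (q.2 < p.2)%N -> path_sum n p q = 0.
Proof.
elim: n p => [|n IHn] [a b] /=.
  by case: q => c d /= h; rewrite xpair_eqE (_ : _ && _ = false) //; lia.
by move=> h; rewrite !IHn ?mulr0 ?addr0 //=; lia.
Qed.

Lemma path_sum_out n (R : nat -> nat -> bool) p q :
  (forall p s, ~~ R (move p s).1 (move p s).2 -> omega p s = 0) ->
  R p.1 p.2 -> ~~ R q.1 q.2 -> path_sum n p q = 0.
Proof.
move=> omega0; elim: n p => [|n IHn] p Rp Rq /=.
  by case: eqP => // e; rewrite -e Rp in Rq.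
have step s : omega p s * path_sum n (move p s) q = 0.
  have [Rs|out] := boolP (R (move p s).1 (move p s).2).
    by rewrite IHn // mulr0.
  by rewrite omega0 // mul0r.
by rewrite !step addr0.
Qed.

End PathSum.

(** * Path sums between the boundaries as the two recursions *)

Section SinglePath.
Variables (A : comNzRingType) (u v : A) (x y : nat) (T B : lpath x y).
Hypothesis hTB : weakly_above T B.
Local Notation R := (region T B).

(** The indicator gives weight zero to words that leave the region, so a sum over paths between the
    boundaries becomes a sum over all words. *)
Definition step_weight (U V : seq bool) (p : nat * nat) (s : bool) : A :=
  (R (move p s).1 (move p s).2)%:R *
  (if s then v ^+ ((p, s) \in steps V) else u ^+ ((p, s) \in steps U)).

Lemma weight_step (U V : seq bool) p w :
  weight (step_weight U V) p w =
  (all (fun q => R q.1 q.2) (scanl move p w))%:R *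
  (u ^+ count (fun s => (s.2 == East) && (s \in steps U))
        (zip (p :: scanl move p w) w) *
   v ^+ count (fun s => (s.2 == North) && (s \in steps V))
        (zip (p :: scanl move p w) w)).
Proof.
elim: w p => [|s w IHw] p; first by rewrite /= !expr0 !mulr1.
rewrite [LHS]/= IHw [scanl _ _ _]/= [zip _ _]/= [all _ _]/= /step_weight.
by case: s; rewrite /= !exprD -[in RHS]mulnb natrM; ring.
Qed.

Lemma paths_between_region (P : lpath x y) :
  (P \in paths_between T B) = all (fun q => R q.1 q.2) (scanl move (0, 0)%N P).
Proof.
have -> : all (fun q => R q.1 q.2) (scanl move (0, 0)%N P) =
    all (fun q => R q.1 q.2) (points P) by rewrite /= region_origin.
rewrite inE; apply/andP/allP => [[/weakly_aboveP lePB /weakly_aboveP leTP] q | inR].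
  rewrite mem_points => /andP[_ /eqP hq].
  by rewrite /region -[X in (_ <= X <= _)%N]hq lePB leTP.
suff h i : (height B i <= height P i <= height T i)%N.
  by split; apply/weakly_aboveP => i; case/andP: (h i).
have [le|lt] := leqP (x + y) i; first by rewrite !height_end ?leqnn.
have /inR : (i - height P i, height P i)%N \in points P.
  by rewrite mem_points size_lpath /= subnK ?height_le // eqxx andbT ltnW.
by rewrite /region /= subnK ?height_le.
Qed.

Lemma sum_paths_between (U V : seq bool) :
  \sum_(P in paths_between T B) u ^+ common_steps East P U * v ^+ common_steps North P V
  = path_sum (step_weight U V) (x + y) (0, 0)%N (x, y).
Proof.
rewrite -path_sum_tuple.
(* Words that do not end at [(x, y)] contribute zero; the others are the elements of [lpath x y]. *)
rewrite (bigID (fun w : (x + y).-tuple bool => endpoint w == (x, y))) /=.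
rewrite [X in _ + X]big1 ?addr0; last first.
  by move=> w /negPf; rewrite /endpoint => ->; rewrite mul0r.
rewrite (reindex_omap (@word x y) insub) /=; last first.
  by move=> w ew; rewrite insubT.
rewrite big_mkcond /=; apply: eq_big => [P|P _].
  by case: P => w ew /=; rewrite ew insubT eqxx.
rewrite weight_step paths_between_region.
have -> : foldl move (0, 0)%N P == (x, y) by case: P.
by rewrite mul1r; case: all; rewrite ?mul1r ?mul0r.
Qed.

Lemma step_weight_out U V p s :
  ~~ R (move p s).1 (move p s).2 -> step_weight U V p s = 0.
Proof. by rewrite /step_weight => /negPf->; rewrite mul0r. Qed.

(** A predecessor outside the region contributes zero by [path_sum_out]. The step from one inside is
    a boundary step exactly when the other predecessor is missing, which is the weighting of
    [tutte_step]. *)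
Lemma path_sum_last_sum n c d : n = (c + d)%N -> (n <= x + y)%N -> R c d ->
  path_sum (step_weight B T) n (0, 0)%N (c, d) = last_sum u v R n 0 0 c d.
Proof.
elim: n c d => [|n IHn] c d def_n le_n Rcd.
  by have [-> ->] : c = 0%N /\ d = 0%N by lia.
rewrite path_sum_last.
have := @prev_in_region _ (@region_row _ _ T B) (@region_col _ _ T B)
  (region_prev hTB) 0 0 c d isT isT _ (region_origin _ _) Rcd.
rewrite -def_n => /(_ isT).
have out q : ~~ R q.1 q.2 -> path_sum (step_weight B T) n (0, 0)%N q = 0.
  apply: (@path_sum_out _ _ n R (0, 0)%N q _ (region_origin T B)) => p s.
  exact: step_weight_out.
have -> : (0 < d)%:R * path_sum (step_weight B T) n (0, 0)%N (c, d.-1) *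
    step_weight B T (c, d.-1) North = ((0 < d)%N && R c d.-1)%:R *
    last_sum u v R n 0 0 c d.-1 * v ^+ ~~ ((0 < c)%N && R c.-1 d).
  case: d def_n Rcd => [|d] def_n Rcd; first by rewrite !mul0r.
  have [Rd|nRd] := boolP (R c d); last by rewrite /= out ?mulr0 ?mul0r.
  rewrite /= IHn //; try lia.
  by rewrite /step_weight /= Rcd (@north_step_top _ _ T B) //; [rewrite !mul1r | lia].
have -> : (0 < c)%:R * path_sum (step_weight B T) n (0, 0)%N (c.-1, d) *
    step_weight B T (c.-1, d) East = ((0 < c)%N && R c.-1 d)%:R *
    last_sum u v R n 0 0 c.-1 d * u ^+ ~~ ((0 < d)%N && R c d.-1).
  case: c def_n Rcd {out} (out) => [|c] def_n Rcd out; first by rewrite !mul0r.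
  have [Rd|nRd] := boolP (R c d); last by rewrite /= out ?mulr0 ?mul0r.
  rewrite /= IHn //; try lia.
  by rewrite /step_weight /= Rcd (@east_step_bottom _ _ T B) //; [rewrite !mul1r | lia].
rewrite /= /tutte_step; case: (_ && _); case: (_ && _) => //= _;
  rewrite ?expr0 ?expr1; ring.
Qed.

(** The mirror argument at the start of the path. Steps past abscissa [x] or ordinate [y] are ruled
    out by [path_sum_gt], since no path returns from there to [(x, y)]. *)
Lemma path_sum_first_sum n a b : (a <= x)%N -> (b <= y)%N ->
  n = ((x - a) + (y - b))%N -> R a b ->
  path_sum (step_weight T B) n (a, b) (x, y) = first_sum u v R n a b x y.
Proof.
elim: n a b => [|n IHn] a b ax by_ def_n Rab.
  by have [-> ->] : a = x /\ b = y; [lia | rewrite /= eqxx].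
have lt_ab : (a + b < x + y)%N by lia.
have := @next_in_region _ (@region_row _ _ T B) (@region_col _ _ T B)
  (region_next hTB) a b x y ax by_ lt_ab Rab (region_end _ _).
rewrite [path_sum _ _ _ _]/= /move /=.
have -> : step_weight T B (a, b) North * path_sum (step_weight T B) n (a, b.+1) (x, y)
   = ((b < y)%N && R a b.+1)%:R *
    first_sum u v R n a b.+1 x y * v ^+ ~~ ((a < x)%N && R a.+1 b).
  have [ltb|leb] := ltnP b y; last by rewrite path_sum_gt ?mulr0 ?mul0r //= ltnS leb orbT.
  have [Rb|nRb] := boolP (R a b.+1); last by rewrite step_weight_out ?mul0r.
  rewrite IHn //; try lia.
  by rewrite /step_weight /= Rb (@north_step_bottom _ _ T B) // !mul1r mulrC.
have -> : step_weight T B (a, b) East * path_sum (step_weight T B) n (a.+1, b) (x, y)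
   = ((a < x)%N && R a.+1 b)%:R *
    first_sum u v R n a.+1 b x y * u ^+ ~~ ((b < y)%N && R a b.+1).
  have [lta|lea] := ltnP a x; last by rewrite path_sum_gt ?mulr0 ?mul0r //= ltnS lea.
  have [Ra|nRa] := boolP (R a.+1 b); last by rewrite step_weight_out ?mul0r.
  rewrite IHn //; try lia.
  by rewrite /step_weight /= Ra (@east_step_top _ _ T B) // !mul1r mulrC.
rewrite /tutte_step; case: (_ && _); case: (_ && _) => //= _;
  rewrite ?expr0 ?expr1; ring.
Qed.

Lemma single_path :
  \sum_(P in paths_between T B) u ^+ common_steps East P B * v ^+ common_steps North P T =
  \sum_(P in paths_between T B) u ^+ common_steps East P T * v ^+ common_steps North P B.
Proof.
rewrite !sum_paths_between path_sum_last_sum ?region_end //.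
rewrite path_sum_first_sum ?subn0 ?region_origin //.
apply: last_sum_first_sum; rewrite ?subn0 ?region_origin ?region_end //.
- exact: region_row.
- exact: region_col.
- exact: region_prev.
- exact: region_next.
Qed.

End SinglePath.

(** * Tuples of paths *)

Lemma uniq_steps_from p w : uniq (zip (p :: scanl move p w) w).
Proof.
elim: w p => [|s w IHw] p //=.
by case: p => a b; rewrite IHw andbT mem_steps_from /move /=; case: s => /=; lia.
Qed.

(** A path uses no unit step twice, so both sides count the same set. This reconciles the
    statistics, which list the path of the tuple first, with the kernels, which list the upper path
    first. *)
Lemma common_stepsC d P Q : common_steps d P Q = common_steps d Q P.
Proof.
rewrite /common_steps -!size_filter; apply/perm_size/uniq_perm.
- exact/filter_uniq/uniq_steps_from.
- exact/filter_uniq/uniq_steps_from.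
- by move=> s; rewrite !mem_filter -!andbA [(s \in _) && _]andbC.
Qed.

(** * Products of kernels and weighted chains *)

Section Kernels.
Variables (A : comNzRingType) (I : finType).
Implicit Types K L M : I -> I -> A.

Definition kernel_mul K L (S U : I) : A := \sum_P K S P * L P U.

Lemma kernel_mulA K L M S U :
  kernel_mul K (kernel_mul L M) S U = kernel_mul (kernel_mul K L) M S U.
Proof.
rewrite /kernel_mul; under eq_bigr do rewrite mulr_sumr.
rewrite exchange_big /=; apply: eq_bigr => Q _.
by rewrite mulr_suml; apply: eq_bigr => P _; rewrite mulrA.
Qed.

Lemma eq_kernel_mul K K' L L' : K =2 K' -> L =2 L' ->
  kernel_mul K L =2 kernel_mul K' L'.
Proof. by move=> eK eL S U; apply: eq_bigr => P _; rewrite eK eL. Qed.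

(** For nonempty [s], [K] weighs the first link of the chain from [S] through [s] to [U], [L] the
    last one and [M] all links between. *)
Fixpoint chain_weight K M L (S : I) (s : seq I) (U : I) : A :=
  if s is P :: s' then K S P * chain_weight M M L P s' U else L S U.

Lemma sum_chain_weight K M L n S U :
  \sum_(t : n.+1.-tuple I) chain_weight K M L S t U =
  kernel_mul K (iter n (kernel_mul M) L) S U.
Proof.
elim: n K S => [|n IHn] K S; rewrite big_tuple_cons; apply: eq_bigr => P _.
  rewrite (big_pred1 [tuple]) // => t.
  by rewrite [t]tuple0 /= eq_refl.
by rewrite /= -IHn mulr_sumr.
Qed.

Lemma kernel_mul_iter K M L n :
  kernel_mul K M =2 kernel_mul M K ->
  kernel_mul K (iter n (kernel_mul M) L) =2 iter n (kernel_mul M) (kernel_mul K L).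
Proof.
move=> KM; elim: n => [|n IHn] S U //=.
rewrite kernel_mulA (eq_kernel_mul KM (fun _ _ => erefl)) -kernel_mulA.
exact: eq_kernel_mul.
Qed.

Lemma eq_iter_kernel M L L' n : L =2 L' ->
  iter n (kernel_mul M) L =2 iter n (kernel_mul M) L'.
Proof. by move=> eL; elim: n => //= n IHn; apply: eq_kernel_mul. Qed.

(** In product notation, K M^n L = M^n K L = M^n L K = L M^n K. *)
Lemma kernel_mul_iter_swap K M L n :
  kernel_mul K M =2 kernel_mul M K -> kernel_mul L M =2 kernel_mul M L ->
  kernel_mul K L =2 kernel_mul L K ->
  kernel_mul K (iter n (kernel_mul M) L) =2 kernel_mul L (iter n (kernel_mul M) K).
Proof.
move=> KM LM KL S U.
by rewrite !kernel_mul_iter //; apply: eq_iter_kernel.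
Qed.

End Kernels.

(** * Contact kernels and tuples of paths *)

Section Tuples.
Variables (A : comNzRingType) (x y : nat).
Implicit Types (T B P Q : lpath x y).

(** For [d] equal to [North] and [East] these are the matrices N_v and E_u. *)
Definition contact_kernel (d : bool) (z : A) P Q : A :=
  (weakly_above P Q)%:R * z ^+ common_steps d P Q.

(** For [T] above [B] the entry is given by [single_path]; otherwise both entries vanish, since the
    order is transitive. *)
Lemma contact_kernelC (u v : A) :
  kernel_mul (contact_kernel North v) (contact_kernel East u) =2
  kernel_mul (contact_kernel East u) (contact_kernel North v).
Proof.
move=> T B; have [hTB|nTB] := boolP (weakly_above T B); last first.
  rewrite /kernel_mul !big1 // => P _; rewrite /contact_kernel;
    have [TP|] := boolP (weakly_above T P); rewrite ?mul0r //;
    have [PB|] := boolP (weakly_above P B); rewrite ?mul0r ?mulr0 //;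
    by rewrite (weakly_above_trans TP PB) in nTB.
have := single_path u v hTB; rewrite /kernel_mul big_mkcond [X in _ = X -> _]big_mkcond.
move=> e; apply: etrans (etrans e _); apply: eq_bigr => P _; rewrite /contact_kernel inE;
  case: weakly_above; case: weakly_above; rewrite ?(mul0r, mulr0, mul1r) //.
- by rewrite mulrC [common_steps North _ _]common_stepsC.
- by rewrite [common_steps East _ _]common_stepsC.
Qed.

Definition order_kernel P Q : A := (weakly_above P Q)%:R.

Lemma contact_kernel1 d : contact_kernel d 1 =2 order_kernel.
Proof. by move=> P Q; rewrite /contact_kernel expr1n mulr1. Qed.

Lemma north_order_kernelC (v : A) :
  kernel_mul (contact_kernel North v) order_kernel =2
  kernel_mul order_kernel (contact_kernel North v).
Proof.
move=> T B; have := contact_kernelC 1 v T B.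
by rewrite (eq_kernel_mul (fun _ _ => erefl) (contact_kernel1 East))
  (eq_kernel_mul (contact_kernel1 East) (fun _ _ => erefl)).
Qed.

Lemma east_order_kernelC (u : A) :
  kernel_mul (contact_kernel East u) order_kernel =2
  kernel_mul order_kernel (contact_kernel East u).
Proof.
move=> T B; have := contact_kernelC u 1 T B.
by rewrite (eq_kernel_mul (fun _ _ => erefl) (contact_kernel1 North))
  (eq_kernel_mul (contact_kernel1 North) (fun _ _ => erefl)).
Qed.

(** Transitivity along the chain from [T] through the tuple to [B] places every entry between the
    boundaries, so only the two ends need a test. *)
Lemma mem_path_tuples k T B (P : k.-tuple (lpath x y)) S s : P = S :: s :> seq _ ->
  (P \in path_tuples k T B) =
  [&& weakly_above T S, path (fun Q R : lpath x y => weakly_above Q R) S s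
    & weakly_above (last S s) B].
Proof.
move=> defP; rewrite inE defP; apply/andP/and3P => [[/allP inTB Ss] | [TS Ss sB]].
  split=> //.
    by have /inTB := mem_head S s; rewrite inE => /andP[].
  by have /inTB := mem_last S s; rewrite inE => /andP[].
split=> //; have : path (fun Q R : lpath x y => weakly_above Q R) T (rcons (S :: s) B).
  by rewrite rcons_path /= TS Ss sB.
rewrite -[path _ _ _]/(sorted _ (T :: rcons (S :: s) B)).
rewrite (sorted_pairwise (@weakly_above_trans x y)) pairwise_cons.
rewrite pairwise_rcons all_rcons => /and3P[/andP[_ /allP aboveT] /allP aboveB _].
by apply/allP => Q sQ; rewrite inE aboveT ?aboveB.
Qed.

Lemma chain_weight_contact (K : lpath x y -> lpath x y -> A) d z T S s B :
  chain_weight K order_kernel (contact_kernel d z) T (S :: s) B =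
  K T S * (path (fun Q R : lpath x y => weakly_above Q R) S s &&
           weakly_above (last S s) B)%:R * z ^+ common_steps d (last S s) B.
Proof.
elim: s K T S => [|R s IHs] K T S; first by rewrite /= mulrA.
rewrite [LHS]/= -/(chain_weight _ _ _ _ (R :: s) B) IHs /= /order_kernel.
by rewrite -!mulrA; case: (weakly_above S R); rewrite ?mul1r ?mul0r.
Qed.

Lemma sum_path_tuples n d d' (z z' : A) T B :
  \sum_(P in path_tuples n.+1 T B)
     z ^+ common_steps d (head T P) T * z' ^+ common_steps d' (last B P) B =
  kernel_mul (contact_kernel d z)
    (iter n (kernel_mul order_kernel) (contact_kernel d' z')) T B.
Proof.
rewrite -sum_chain_weight big_mkcond; apply: eq_bigr => P _.
case/tupleP: P => S P; rewrite (@mem_path_tuples _ _ _ _ S P) //.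
rewrite chain_weight_contact /= [common_steps d S T]common_stepsC /contact_kernel.
by case: (weakly_above T S) => /=; case: (_ && _); rewrite ?(mul1r, mul0r, mulr1, mulr0).
Qed.

Lemma sum_path_tuples_sym k (u v : A) T B : (0 < k)%N ->
  \sum_(P in path_tuples k T B) u ^+ stat_b B P * v ^+ stat_l T P =
  \sum_(P in path_tuples k T B) u ^+ stat_t T P * v ^+ stat_r B P.
Proof.
case: k => // n _; rewrite [RHS]sum_path_tuples.
(* The north factor, attached to [T], is moved first; the two sides become N_v M^n E_u and E_u M^n
   N_v. *)
under eq_bigr do rewrite mulrC.
rewrite sum_path_tuples; apply: kernel_mul_iter_swap.
- exact: north_order_kernelC.
- exact: east_order_kernelC.
- exact: contact_kernelC.
Qed.

End Tuples.

(** * From generating polynomials to joint counts *)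

(** Reads the joint distribution off the generating polynomial. The exponents [g P] belong to the
    outer variable, hence the coefficient of index [j] is taken first. *)
Lemma coef_sum_monomials (I : finType) (D : {set I}) (f g : I -> nat) i j :
  (\sum_(P in D) ('X%:P : {poly {poly int}}) ^+ f P * 'X ^+ g P)`_j`_i =
  #|[set P in D | (f P == i) && (g P == j)]|%:R.
Proof.
rewrite !coef_sum -sum1_card natr_sum big_mkcond [RHS]big_mkcond.
apply: eq_bigr => P _; rewrite inE; case: (P \in D) => //=.
rewrite -polyC_exp coefCM coefXn [j == _]eq_sym.
by case: (g P == j); rewrite ?andbF ?mulr0 ?coef0 // mulr1 andbT coefXn eq_sym; case: eqP.
Qed.

Theorem theorem2p4 (x y k : nat) (T B : lpath x y) (hTB : weakly_above T B)
    (hk : (1 <= k)%N) :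
  (forall i j : nat,
     #|[set P in path_tuples k T B | (stat_b B P == i) && (stat_l T P == j)]| =
     #|[set P in path_tuples k T B | (stat_t T P == i) && (stat_r B P == j)]|)
  /\
  (let u : {poly {poly int}} := 'X%:P in
   let v : {poly {poly int}} := 'X in
   \sum_(P in path_tuples k T B) u ^+ stat_b B P * v ^+ stat_l T P =
   \sum_(P in path_tuples k T B) u ^+ stat_t T P * v ^+ stat_r B P).
Proof.
have eq_sum := sum_path_tuples_sym ('X%:P : {poly {poly int}}) 'X T B hk.
split=> // i j; apply/eqP; rewrite -(Num.Theory.eqr_nat int) -!coef_sum_monomials; apply/eqP.
by rewrite eq_sum.
Qed.
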